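(* Let $R$ be an associative ring with unit, let $(\mathcal T,\mathcal S)$ be a hereditary Tor-pair over $R$, and let $n$ be a natural number ($n=0$ is allowed). The following assertions are equivalent: (1) each product of modules in $\mathcal T$ has $\mathcal T$-projective dimension less than or equal to $n$; (2) each module in $\mathcal S$ has finite $\mathrm{ML}(\mathcal T)$-projective dimension less than or equal to $n+1$. Consequently, $$\mathrm{pd}_{\mathcal T}(\mathrm{Prod}(\mathcal T)) = n \iff \mathrm{pd}_{\mathrm{ML}(\mathcal T)}(\mathcal S)=n+1 .$$
   Context: Tor-pairs: for an associative unital ring $R$, a Tor-pair over $R$ is a pair $(\mathcal T,\mathcal S)$, with $\mathcal T$ a class of right $R$-modules and $\mathcal S$ a class of left $R$-modules, such that $\mathcal T$ is the class of all right modules $M$ with $\mathrm{Tor}_1^R(M,S)=0$ for all $S\in\mathcal S$, and $\mathcal S$ is the class of all left modules $N$ with $\mathrm{Tor}_1^R(T,N)=0$ for all $T\in\mathcal T$. A class of modules is resolving if it contains all projective modules and is closed under extensions and under kernels of epimorphisms between its members. The Tor-pair is hereditary if $\mathcal T$ is resolving. Relative dimension: let $\mathcal X$ be a class of (left or right) modules containing all projective modules. For a projective resolution $\cdots\to P_1\xrightarrow{d_1}P_0\xrightarrow{d_0}M\to 0$ the $n$th syzygy is $\ker d_n$. Set $\mathcal X_0=\mathcal X$ and, for $n\ge 1$, let $\mathcal X_n$ be the class of modules $M$ having a projective resolution whose $(n-1)$st syzygy belongs to $\mathcal X$; ''$M$ has $\mathcal X$-projective dimension less than or equal to $n$'' means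 $M\in\mathcal X_n$. Put $\mathrm{pd}_{\mathcal X}(M)=\min(\{m<\omega: M\in\mathcal X_m\}\cup\{\omega\})$, and for a class $\mathcal Y$ of modules put $\mathrm{pd}_{\mathcal X}(\mathcal Y)=\sup\{\mathrm{pd}_{\mathcal X}(Y):Y\in\mathcal Y\}$. $\mathrm{Prod}(\mathcal X)$ is the class of all modules isomorphic to a direct product of modules in $\mathcal X$. For a class $\mathcal X$ of right $R$-modules, $\mathrm{ML}(\mathcal X)$ is the class of $\mathcal X$-Mittag-Leffler left modules, that is, left $R$-modules $M$ such that for every family $\{X_i:i\in I\}$ of modules in $\mathcal X$ the canonical map $\left(\prod_{i\in I}X_i\right)\otimes_R M\to\prod_{i\in I}(X_i\otimes_R M)$ is injective.
   Formalization: For n = 0 the final pd equivalence additionally assumes that some module in S is not in ML(T); otherwise it fails, since then pd_T(Prod(T)) = 0 and pd_ML(T)(S) = 0 rather than 1 (e.g. over a field with T and S all modules). *)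

(* Defs.v *)
From HB Require Import structures.
From mathcomp Require Import all_boot all_algebra.
From mathcomp Require Import boolp.
From mathcomp Require Import freeg.

Set Implicit Arguments.
Unset Strict Implicit.
Unset Printing Implicit Defensive.
Import GRing.Theory.
Local Open Scope ring_scope.
Local Open Scope quotient_scope.

(* Rings are associative with unit and possibly zero (pzRingType).  A left
   R-module is an [lmodType R]; a right R-module is an [lmodType R^c], with
   [r *: x] standing for the right action x r. *)

Section Kernel.
Variables (U V : zmodType) (f : {additive U -> V}).

Record kernel := Kernel { ker_val : U; _ : f ker_val == 0 }.

HB.instance Definition _ := [isSub for ker_val].
HB.instance Definition _ := [Choice of kernel by <:].

Lemma ker_zmod_closed : zmod_closed [pred x | f x == 0].
Proof.
split=> [|x y]; rewrite !inE ?raddf0 ?eqxx //.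
by move=> /eqP fx /eqP fy; rewrite raddfB fx fy subr0.
Qed.

HB.instance Definition _ :=
  GRing.SubChoice_isSubZmodule.Build U [pred x | f x == 0] kernel ker_zmod_closed.

Lemma kernelP (x : kernel) : f (ker_val x) = 0.
Proof. by apply/eqP; case: x. Qed.

End Kernel.

Section KernelModule.
Variables (R : pzRingType) (U V : lmodType R) (f : {linear U -> V}).

Lemma ker_submod_closed : subsemimod_closed [pred x | f x == 0].
Proof.
split; last by move=> a x; rewrite !inE linearZ_LR => /eqP ->; rewrite scaler0.
split=> [|x y]; rewrite !inE ?linear0 ?eqxx //.
by move=> /eqP fx /eqP fy; rewrite linearD fx fy addr0.
Qed.

HB.instance Definition _ :=
  GRing.SubZmodule_isSubLmodule.Build R U [pred x | f x == 0] (kernel f)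
    ker_submod_closed.

End KernelModule.

Definition prod_mod (R : pzRingType) (I : Type) (X : I -> lmodType R) : Type :=
  forall i, X i.

Section Product.
Variables (R : pzRingType) (I : Type) (X : I -> lmodType R).
Implicit Types x y z : prod_mod X.

HB.instance Definition _ := gen_eqMixin (prod_mod X).
HB.instance Definition _ := gen_choiceMixin (prod_mod X).

Definition prod_zero : prod_mod X := fun=> 0.
Definition prod_opp x : prod_mod X := fun i => - x i.
Definition prod_add x y : prod_mod X := fun i => x i + y i.
Definition prod_scale (a : R) x : prod_mod X := fun i => a *: x i.

Lemma prod_addA : associative prod_add.
Proof. by move=> x y z; apply: functional_extensionality_dep => i; apply: addrA. Qed.
Lemma prod_addC : commutative prod_add.
Proof. by move=> x y; apply: functional_extensionality_dep => i; apply: addrC. Qed.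
Lemma prod_add0 : left_id prod_zero prod_add.
Proof. by move=> x; apply: functional_extensionality_dep => i; apply: add0r. Qed.
Lemma prod_addN : left_inverse prod_zero prod_opp prod_add.
Proof. by move=> x; apply: functional_extensionality_dep => i; apply: addNr. Qed.

HB.instance Definition _ :=
  GRing.isZmodule.Build (prod_mod X) prod_addA prod_addC prod_add0 prod_addN.

Lemma prod_scaleA a b x : prod_scale a (prod_scale b x) = prod_scale (a * b) x.
Proof. by apply: functional_extensionality_dep => i; apply: scalerA. Qed.
Lemma prod_scale1 : left_id 1 prod_scale.
Proof. by move=> x; apply: functional_extensionality_dep => i; apply: scale1r. Qed.
Lemma prod_scaleDr : right_distributive prod_scale +%R.
Proof. by move=> a x y; apply: functional_extensionality_dep => i; apply: scalerDr. Qed.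
Lemma prod_scaleDl x : {morph prod_scale^~ x : a b / a + b}.
Proof. by move=> a b; apply: functional_extensionality_dep => i; apply: scalerDl. Qed.

HB.instance Definition _ := GRing.Zmodule_isLmodule.Build R (prod_mod X)
  prod_scaleA prod_scale1 prod_scaleDr prod_scaleDl.

Definition proj (i : I) x : X i := x i.

Lemma proj_is_linear i : linear (proj i).
Proof. by []. Qed.

HB.instance Definition _ i :=
  GRing.isLinear.Build R (prod_mod X) (X i) *:%R (proj i) (proj_is_linear i).

End Product.

Section Tensor.
Variables (R : pzRingType) (M : lmodType R^c) (N : lmodType R).

Local Notation F := {freeg (M * N)%type / int}.

Inductive tensor_relator : F -> Prop :=
| RelDl (x x' : M) (y : N) :
    tensor_relator (<< (x + x', y) >> - << (x, y) >> - << (x', y) >>)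
| RelDr (x : M) (y y' : N) :
    tensor_relator (<< (x, y + y') >> - << (x, y) >> - << (x, y') >>)
| RelZ (r : R) (x : M) (y : N) :
    tensor_relator (<< ((r : R^c) *: x, y) >> - << (x, r *: y) >>).

(* the subgroup generated by the relators *)
Definition tensor_null (u : F) : bool :=
  `[< forall H : zmodClosed F, (forall v, tensor_relator v -> v \in H) ->
      u \in H >].

Lemma tensor_null_closed : zmod_closed tensor_null.
Proof.
split=> [|u v /asboolP Hu /asboolP Hv]; apply/asboolP => H rel; first exact: rpred0.
by apply: rpredB; [apply: Hu | apply: Hv].
Qed.

Definition tensor_null_subgroup : zmodClosed F :=
  HB.pack_for (zmodClosed F) tensor_null
    (GRing.isZmodClosed.Build F tensor_null tensor_null_closed).

Local Notation Q := (Quotient.quot tensor_null_subgroup).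

Definition tensor : zmodType := Q.

Definition tens (x : M) (y : N) : tensor :=
  \pi_Q << (x, y) >>.

Record balanced (A : zmodType) := Balanced {
  bal_fun :> M -> N -> A;
  bal_Dl : forall x x' y, bal_fun (x + x') y = bal_fun x y + bal_fun x' y;
  bal_Dr : forall x y y', bal_fun x (y + y') = bal_fun x y + bal_fun x y';
  bal_Z : forall (r : R) x y, bal_fun ((r : R^c) *: x) y = bal_fun x (r *: y)
}.

Lemma tensDl x x' y : tens (x + x') y = tens x y + tens x' y.
Proof.
apply/eqP; rewrite -subr_eq0 opprD addrA /tens -!raddfB -(raddf0 (\pi_Q)).
rewrite -Quotient.idealrBE subr0.
by apply/asboolP => H; apply; apply: RelDl.
Qed.

Lemma tensDr x y y' : tens x (y + y') = tens x y + tens x y'.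
Proof.
apply/eqP; rewrite -subr_eq0 opprD addrA /tens -!raddfB -(raddf0 (\pi_Q)).
rewrite -Quotient.idealrBE subr0.
by apply/asboolP => H; apply; apply: RelDr.
Qed.

Lemma tensZ (r : R) x y : tens ((r : R^c) *: x) y = tens x (r *: y).
Proof.
apply/eqP; rewrite /tens -Quotient.idealrBE.
by apply/asboolP => H; apply; apply: RelZ.
Qed.

Section Lift.
Variables (A : zmodType) (b : balanced A).

Definition free_lift (u : F) : A :=
  fglift (fun p : (M * N)%type => b p.1 p.2 : zmodule A) u.

Lemma free_lift_is_additive : zmod_morphism free_lift.
Proof.
move=> u v.
exact: (lift_is_additive (fun p : (M * N)%type => b p.1 p.2 : zmodule A) u v).
Qed.

HB.instance Definition _ :=
  GRing.isZmodMorphism.Build F A free_lift free_lift_is_additive.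

Lemma free_liftU x y : free_lift << (x, y) >> = b x y.
Proof. by rewrite /free_lift liftU scale1r. Qed.

Lemma free_lift_null u : u \in tensor_null -> free_lift u = 0.
Proof.
pose K := [pred u | free_lift u == 0].
have Kc : zmod_closed K by apply: ker_zmod_closed.
pose KB := GRing.isZmodClosed.Build F K Kc.
pose KC : zmodClosed F := HB.pack_for (zmodClosed F) (K : F -> bool) KB.
move=> /asboolP /(_ KC) Hu; apply/eqP; apply: Hu => v rel.
change (free_lift v == 0).
by case: rel => *; rewrite !raddfB /= !free_liftU (bal_Dl, bal_Dr, bal_Z)
  ?subrr // addrAC addrK subrr.
Qed.

Definition tensor_lift (t : tensor) : A :=
  free_lift (repr (t : Q)).

Lemma tensor_lift_pi u :
  tensor_lift (\pi_Q u) = free_lift u.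
Proof.
apply/eqP; rewrite -subr_eq0 -raddfB; apply/eqP/free_lift_null.
rewrite -[_ \in _]/(_ \in tensor_null_subgroup).
by rewrite Quotient.idealrBE reprK.
Qed.

Lemma tensor_lift_is_additive : zmod_morphism tensor_lift.
Proof.
by elim/quotW=> u; elim/quotW=> v; rewrite -raddfB !tensor_lift_pi raddfB.
Qed.

HB.instance Definition _ :=
  GRing.isZmodMorphism.Build tensor A tensor_lift tensor_lift_is_additive.

Lemma tensor_liftE x y : tensor_lift (tens x y) = b x y.
Proof. by rewrite tensor_lift_pi free_liftU. Qed.

End Lift.

Lemma tensor_ext (A : zmodType) (f g : {additive tensor -> A}) :
  (forall x y, f (tens x y) = g (tens x y)) -> f =1 g.
Proof.
move=> fg; elim/quotW=> u; rewrite -(freeg_sumE u) !raddf_sum /=.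
apply: eq_bigr => -[x y] _; set c := coeff _ _.
rewrite -[c]intz -freegU_mulz.
by rewrite !raddfMz; congr (_ *~ _); apply: fg.
Qed.

End Tensor.

Section TensorMap.
Variables (R : pzRingType) (M M' : lmodType R^c) (N N' : lmodType R).
Variables (f : {linear M -> M'}) (g : {linear N -> N'}).

Lemma tensor_map_Dl x x' y :
  tens (f (x + x')) (g y) = tens (f x) (g y) + tens (f x') (g y).
Proof. by rewrite linearD tensDl. Qed.
Lemma tensor_map_Dr x y y' :
  tens (f x) (g (y + y')) = tens (f x) (g y) + tens (f x) (g y').
Proof. by rewrite linearD tensDr. Qed.
Lemma tensor_map_Z (r : R) x y :
  tens (f ((r : R^c) *: x)) (g y) = tens (f x) (g (r *: y)).
Proof. by rewrite !linearZ_LR tensZ. Qed.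

Definition tensor_map : {additive tensor M N -> tensor M' N'} :=
  tensor_lift (@Balanced R M N _ (fun x y => tens (f x) (g y))
                 tensor_map_Dl tensor_map_Dr tensor_map_Z).

Lemma tensor_mapE x y : tensor_map (tens x y) = tens (f x) (g y).
Proof. exact: tensor_liftE. Qed.

End TensorMap.

Definition projective (R : pzRingType) (P : lmodType R) : Prop :=
  forall (A B : lmodType R) (g : {linear A -> B}) (f : {linear P -> B}),
    (forall b, exists a, g a = b) ->
    exists h : {linear P -> A}, forall x, g (h x) = f x.

Definition exact_at (A B C : zmodType) (f : A -> B) (g : B -> C) : Prop :=
  forall y, g y = 0 <-> exists x, f x = y.

(* ... -> P_2 -> P_1 -> P_0 -> M -> 0, where res_aug = d_0 and
   res_d k = d_{k+1} *)
Record resolution (R : pzRingType) (M : lmodType R) := Resolution {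
  res_mod : nat -> lmodType R;
  res_aug : {linear res_mod 0%N -> M};
  res_d : forall k, {linear res_mod k.+1 -> res_mod k};
  res_proj : forall k, projective (res_mod k);
  res_aug_surj : forall x, exists p, res_aug p = x;
  res_exact0 : exact_at (res_d 0) res_aug;
  res_exactS : forall k, exact_at (res_d k.+1) (res_d k)
}.

Definition syzygy (R : pzRingType) (M : lmodType R) (P : resolution M) (k : nat) :
    lmodType R :=
  if k is j.+1 then kernel (res_d P j) else kernel (res_aug P).

Section Homology.
Variables (A B C : zmodType) (f : {additive A -> B}) (g : {additive B -> C}).

Definition boundary (z : kernel g) : bool := `[< exists x, f x = ker_val z >].

Lemma boundary_closed : zmod_closed boundary.
Proof.
split=> [|u v /asboolP[x fx] /asboolP[y fy]]; apply/asboolP.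
  by exists 0; rewrite raddf0.
by exists (x - y); rewrite raddfB fx fy.
Qed.

Definition boundary_subgroup : zmodClosed (kernel g) :=
  HB.pack_for (zmodClosed (kernel g)) boundary
    (GRing.isZmodClosed.Build (kernel g) boundary boundary_closed).

Definition homology : zmodType := Quotient.quot boundary_subgroup.

Lemma homology_eq0 : (forall t : homology, t = 0) <->
  forall y, g y = 0 -> exists x, f x = y.
Proof.
split=> [h y /eqP gy|h].
  have := h (\pi_(Quotient.quot boundary_subgroup) (Kernel gy)).
  rewrite -(raddf0 \pi_(Quotient.quot boundary_subgroup)) => /eqP.
  by rewrite -Quotient.idealrBE subr0 => /asboolP.
elim/quotW=> z; rewrite -(raddf0 \pi_(Quotient.quot boundary_subgroup)).
by apply/eqP; rewrite -Quotient.idealrBE subr0; apply/asboolP/h/kernelP.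
Qed.

End Homology.

(* Tor_1^R(M, N), computed from a projective resolution P of M *)
Definition Tor1 (R : pzRingType) (M : lmodType R^c) (P : resolution M)
    (N : lmodType R) : zmodType :=
  homology (tensor_map (res_d P 1) (idfun : {linear N -> N}))
           (tensor_map (res_d P 0) (idfun : {linear N -> N})).

Section Free.
Variables (R : pzRingType) (I : choiceType).

Local Notation RI := (prod_mod (fun _ : I => R^o : lmodType R)).

Definition finsupp_in (u : RI) (s : seq I) : Prop :=
  forall i, i \notin s -> u i = 0.

Definition finsupp_pred (u : RI) : bool := `[< exists s, finsupp_in u s >].

Record free_mod := FreeMod { free_val : RI; _ : finsupp_pred free_val }.

HB.instance Definition _ := [isSub for free_val].
HB.instance Definition _ := [Choice of free_mod by <:].

Lemma finsupp_closed : subsemimod_closed finsupp_pred.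
Proof.
split=> [|a u /asboolP[s us]]; last first.
  by apply/asboolP; exists s => i /us ui; rewrite -[LHS]/(a *: u i) ui scaler0.
split=> [|u v /asboolP[s us] /asboolP[s' vs]]; apply/asboolP; first by exists [::].
exists (s ++ s') => i; rewrite mem_cat negb_or => /andP[/us ui /vs vi].
by rewrite -[LHS]/(u i + v i) ui vi addr0.
Qed.

HB.instance Definition _ :=
  GRing.SubChoice_isSubLmodule.Build R RI finsupp_pred free_mod finsupp_closed.

Definition coef (u : free_mod) (i : I) : R := free_val u i.

Lemma coefE (a : R) (u v : free_mod) i :
  coef (a *: u + v) i = a * coef u i + coef v i.
Proof. by []. Qed.

Definition free_gen_val (i : I) : RI := fun j => (j == i)%:R.

Lemma free_gen_subproof i : finsupp_pred (free_gen_val i).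
Proof.
apply/asboolP; exists [:: i] => j; rewrite inE /free_gen_val.
by case: (j == i).
Qed.

Definition free_gen i : free_mod := FreeMod (free_gen_subproof i).

Lemma free_suppP (u : free_mod) :
  exists s, uniq s && `[< finsupp_in (free_val u) s >].
Proof.
case: u => u /= /asboolP[s us]; exists (undup s); rewrite undup_uniq /=.
by apply/asboolP => i; rewrite mem_undup; apply: us.
Qed.

Definition free_supp u : seq I := xchoose (free_suppP u).

Variables (N : lmodType R) (h : I -> N).

Definition free_ext (u : free_mod) : N :=
  \sum_(i <- free_supp u) coef u i *: h i.

Lemma free_extE u s : uniq s -> finsupp_in (free_val u) s ->
  free_ext u = \sum_(i <- s) coef u i *: h i.
Proof.
have sub t t' : uniq t -> uniq t' -> finsupp_in (free_val u) t ->
    {subset t <= t'} -> \sum_(i <- t) coef u i *: h i =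
                        \sum_(i <- t') coef u i *: h i.
  move=> ut ut' supp tt'; rewrite [RHS](bigID (mem t)) /=.
  rewrite [X in _ + X]big1 ?addr0; last by move=> i /supp ui; rewrite /coef ui scale0r.
  rewrite -[RHS]big_filter; apply: perm_big; apply: uniq_perm => //.
    exact: filter_uniq.
  by move=> i; rewrite mem_filter; case: (boolP (i \in t)) => // /tt' ->.
move=> us supp; have /andP[uu /asboolP uP] := xchooseP (free_suppP u).
rewrite /free_ext; transitivity
  (\sum_(i <- undup (free_supp u ++ s)) coef u i *: h i); last symmetry.
  by apply: sub; rewrite ?undup_uniq // => i; rewrite mem_undup mem_cat => ->.
apply: sub; rewrite ?undup_uniq // => i.
by rewrite mem_undup mem_cat => ->; rewrite orbT.
Qed.

Lemma free_ext_is_linear : linear free_ext.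
Proof.
move=> a u v.
have /andP[_ /asboolP uP] := xchooseP (free_suppP u).
have /andP[_ /asboolP vP] := xchooseP (free_suppP v).
pose s := undup (free_supp u ++ free_supp v).
have us : finsupp_in (free_val u) s.
  by move=> i; rewrite mem_undup mem_cat negb_or => /andP[/uP].
have vs : finsupp_in (free_val v) s.
  by move=> i; rewrite mem_undup mem_cat negb_or => /andP[_ /vP].
have avs : finsupp_in (free_val (a *: u + v)) s.
  move=> i si; rewrite -[LHS]/(a * coef u i + coef v i) /coef.
  by rewrite us // vs // mulr0 addr0.
rewrite !(@free_extE _ s) ?undup_uniq // scaler_sumr -big_split /=.
by apply: eq_bigr => i _; rewrite scalerA -scalerDl.
Qed.

HB.instance Definition _ :=
  GRing.isLinear.Build R free_mod N *:%R free_ext free_ext_is_linear.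

Lemma free_ext_gen i : free_ext (free_gen i) = h i.
Proof.
rewrite (@free_extE _ [:: i]) //; last first.
  by move=> j; rewrite inE /= /free_gen_val => /negPf ->.
by rewrite big_seq1 /= /free_gen_val eqxx scale1r.
Qed.

End Free.

Lemma free_ext_uniq (R : pzRingType) (I : choiceType) (N : lmodType R)
    (f : {linear free_mod R I -> N}) u :
  f u = free_ext (fun i => f (free_gen R i)) u.
Proof.
have /andP[us /asboolP uP] := xchooseP (free_suppP u).
suff {1}-> : u = \sum_(i <- free_supp u) coef u i *: free_gen R i.
  by rewrite linear_sum /free_ext; apply: eq_bigr => i _; rewrite linearZ_LR.
apply: val_inj; apply: functional_extensionality_dep => j.
have valS (s : seq I) : coef (\sum_(i <- s) coef u i *: free_gen R i) j =
    \sum_(i <- s) coef u i * (j == i)%:R.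
  elim: s => [|i s IH]; rewrite ?big_nil // !big_cons -IH.
  by [].
rewrite -[LHS]/(coef u j) -[RHS]/(coef _ j) valS; case: (boolP (j \in free_supp u)) => [js|js].
  rewrite (bigD1_seq j) //= eqxx mulr1 big1 ?addr0 // => i.
  by rewrite eq_sym => /negPf ->; rewrite mulr0.
rewrite /coef uP // big_seq big1 // => i si; case: eqP => [ji|_]; last by rewrite mulr0.
by rewrite ji si in js.
Qed.

Lemma free_projective (R : pzRingType) (I : choiceType) :
  projective (free_mod R I).
Proof.
move=> A B g f gs.
have hE i : {a | g a = f (free_gen R i)} by apply: cid; apply: gs.
exists (free_ext (fun i => sval (hE i))) => u.
rewrite (free_ext_uniq f) -/(_ \o _) -[LHS]/((g \o free_ext _) u).
rewrite (free_ext_uniq (g \o free_ext (fun i => sval (hE i)))) /=.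
by congr free_ext; apply: funext => i; rewrite /= free_ext_gen; case: (hE i).
Qed.

Section StandardResolution.
Variables (R : pzRingType) (M : lmodType R).

Definition cover (N : lmodType R) : {linear free_mod R N -> N} := free_ext id.

Fixpoint std_syzygy (k : nat) : lmodType R :=
  if k is j.+1 then kernel (cover (std_syzygy j)) else M.

Definition std_d k :
    {linear free_mod R (std_syzygy k.+1) -> free_mod R (std_syzygy k)} :=
  (val : kernel (cover (std_syzygy k)) -> _) \o cover (std_syzygy k.+1).

Lemma cover_surj (N : lmodType R) x : exists p, cover N p = x.
Proof. by exists (free_gen R x); apply: free_ext_gen. Qed.

Lemma std_exact (A : zmodType) k (g : {additive free_mod R (std_syzygy k) -> A}) :
  (forall p, g p = 0 <-> cover (std_syzygy k) p = 0) -> exact_at (std_d k) g.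
Proof.
move=> gE y; split=> [/gE/eqP y0|[x <-]].
  have [x xE] := @cover_surj (std_syzygy k.+1) (Kernel y0).
  by exists x; rewrite /std_d /= xE.
by apply/gE; apply: (@kernelP _ _ (cover (std_syzygy k))).
Qed.

Definition std_resolution : resolution M.
Proof.
refine (@Resolution R M (fun k => free_mod R (std_syzygy k)) (cover M) std_d
          (fun k => @free_projective R _) (@cover_surj M) _ _).
- exact: std_exact.
- move=> k; apply: std_exact => p; rewrite /std_d /=; split=> [p0|->].
    by apply: val_inj.
  by [].
Defined.

End StandardResolution.

(* Homologies at degree 1 of different projective resolutions of M are
   isomorphic, so quantifying over all of them amounts to fixing one; they exist by
   std_resolution. *)
Definition Tor1_eq0 (R : pzRingType) (M : lmodType R^c) (N : lmodType R) : Prop :=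
  forall (P : resolution M) (t : Tor1 P N), t = 0.

Definition tor_pair (R : pzRingType) (T : lmodType R^c -> Prop)
    (S : lmodType R -> Prop) : Prop :=
  (forall M, T M <-> forall N, S N -> Tor1_eq0 M N) /\
  (forall N, S N <-> forall M, T M -> Tor1_eq0 M N).

Definition short_exact (R : pzRingType) (A B C : lmodType R)
    (f : {linear A -> B}) (g : {linear B -> C}) : Prop :=
  [/\ injective f, exact_at f g & forall c, exists b, g b = c].

Definition resolving (R : pzRingType) (X : lmodType R -> Prop) : Prop :=
  [/\ forall P : lmodType R, projective P -> X P,
      forall (A B C : lmodType R) (f : {linear A -> B}) (g : {linear B -> C}),
        short_exact f g -> X A -> X C -> X B
    & forall (A B C : lmodType R) (f : {linear A -> B}) (g : {linear B -> C}),
        short_exact f g -> X B -> X C -> X A].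

Definition hereditary_tor_pair (R : pzRingType) (T : lmodType R^c -> Prop)
    (S : lmodType R -> Prop) : Prop :=
  tor_pair T S /\ resolving T.

(* M belongs to X_n: for n = k+1, the (n-1)st syzygy is ker d_k *)
Definition dim_le (R : pzRingType) (X : lmodType R -> Prop) (n : nat)
    (M : lmodType R) : Prop :=
  if n is k.+1 then exists P : resolution M, X (syzygy P k) else X M.

(* Values in omega + 1, with None for omega. *)
Definition least (A : nat -> Prop) : option nat :=
  match pselect (exists m, `[< A m >]) with
  | left exA => Some (ex_minn exA)
  | right _ => None
  end.

Definition pd (R : pzRingType) (X : lmodType R -> Prop) (M : lmodType R) :
    option nat :=
  least (fun m => dim_le X m M).

(* the supremum of pd X M over M in Y, as the least upper bound in omega + 1 *)
Definition pd_class (R : pzRingType) (X Y : lmodType R -> Prop) : option nat :=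
  least (fun b => forall M, Y M -> exists2 m, pd X M = Some m & (m <= b)%N).

Definition Prod (R : pzRingType) (X : lmodType R -> Prop) (M : lmodType R) : Prop :=
  exists (I : Type) (F : I -> lmodType R),
    (forall i, X (F i)) /\ exists f : {linear M -> prod_mod F}, bijective f.

Definition tensor_prod_map (R : pzRingType) (I : Type) (X : I -> lmodType R^c)
    (M : lmodType R) (t : tensor (prod_mod X) M) (i : I) : tensor (X i) M :=
  tensor_map (@proj _ I X i) (idfun : {linear M -> M}) t.

Definition ML (R : pzRingType) (X : lmodType R^c -> Prop) (M : lmodType R) : Prop :=
  forall (I : Type) (F : I -> lmodType R^c), (forall i, X (F i)) ->
    injective (@tensor_prod_map R I F M).

(* Main.v *)
(* Tor_1 vanishing is balanced and shifts: Tor_1(Omega A, N) = 0 iff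
   Tor_1(A, Omega N) = 0, since both say that Omega A (x) Omega N embeds in
   P (x) Q, where P and Q are projectives mapping onto A and N.  Hence prod F has
   T-dimension <= n iff Tor_1(prod F, Omega^n N) = 0 for all N in S.  On the other
   side, if N is in S, then tensoring 0 -> L -> Q -> N -> 0 with the members of T is
   exact, and Q is Mittag-Leffler, so L is T-Mittag-Leffler iff
   Tor_1(prod F, N) = 0 for all families F in T; apply this to Omega^n N, which is
   in S because T is resolving. *)

From HB Require Import structures.
From mathcomp Require Import all_boot all_algebra.
From mathcomp Require Import boolp freeg.
Require Import Defs.

Set Implicit Arguments.
Unset Strict Implicit.
Unset Printing Implicit Defensive.
Import GRing.Theory.
Local Open Scope ring_scope.
Local Open Scope quotient_scope.

(** * Tensor products: induction and functoriality *)

Local Notation "A ⊗> f" := (tensor_map (idfun : {linear A -> A}) f)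
  (at level 40).
Local Notation "f <⊗ N" := (tensor_map f (idfun : {linear N -> N}))
  (at level 40).

(** Negative coefficients are absorbed by the first factor, as -(x ⊗ y) = (-x) ⊗ y, so sums of pure
    tensors exhaust the group. *)
Lemma tensor_ind (R : pzRingType) (M : lmodType R^c) (N : lmodType R)
    (P : tensor M N -> Prop) :
  P 0 -> (forall x y t, P t -> P (tens x y + t)) -> forall t, P t.
Proof.
move=> P0 PD.
have PN x y n t : P t -> P (tens x y *+ n + t).
  move=> Pt; elim: n => [|n IH]; first by rewrite mulr0n add0r.
  by rewrite mulrS -addrA; apply: PD.
have tensN x y : - tens x y = tens (- x) y :> tensor M N.
  apply/eqP; rewrite -subr_eq0 -opprD oppr_eq0 -tensDl subrr.
  apply/eqP; apply: (@addrI _ (tens 0 y)).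
  by rewrite addr0 -tensDl addr0.
elim/quotW=> u; rewrite -(freeg_sumE u) raddf_sum /=.
elim: (dom u) => [|[x y] s IH]; first by rewrite big_nil.
rewrite big_cons; set c := coeff _ _.
have -> : \pi_(tensor M N) << c *g (x, y) >> = tens x y *~ c.
  by rewrite -{1}[c]intz -freegU_mulz raddfMz.
case: c => n; first exact: PN.
by rewrite NegzE mulrNz -mulNrz tensN; apply: PN.
Qed.

Lemma tensor_map_comp (R : pzRingType) (M M' M'' : lmodType R^c)
    (N N' N'' : lmodType R) (f : {linear M -> M'}) (f' : {linear M' -> M''})
    (h : {linear M -> M''}) (g : {linear N -> N'}) (g' : {linear N' -> N''})
    (k : {linear N -> N''}) (t : tensor M N) :
  (forall x, f' (f x) = h x) -> (forall y, g' (g y) = k y) ->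
  tensor_map f' g' (tensor_map f g t) = tensor_map h k t.
Proof.
move=> fh gk; elim/tensor_ind: t => [|x y t IH]; first by rewrite !raddf0.
by rewrite !raddfD IH !tensor_mapE fh gk.
Qed.

Lemma tensor_map_id (R : pzRingType) (M : lmodType R^c) (N : lmodType R)
    (f : {linear M -> M}) (g : {linear N -> N}) (t : tensor M N) :
  f =1 id -> g =1 id -> tensor_map f g t = t.
Proof.
move=> fh gk; elim/tensor_ind: t => [|x y t IH]; first by rewrite !raddf0.
by rewrite !raddfD IH !tensor_mapE fh gk.
Qed.

Lemma tens0l (R : pzRingType) (M : lmodType R^c) (N : lmodType R) (y : N) :
  tens (0 : M) y = 0.
Proof. by apply: (@addrI _ (tens 0 y)); rewrite addr0 -tensDl addr0. Qed.

Lemma tens0r (R : pzRingType) (M : lmodType R^c) (N : lmodType R) (x : M) :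
  tens x (0 : N) = 0.
Proof. by apply: (@addrI _ (tens x 0)); rewrite addr0 -tensDr addr0. Qed.

(** * Right exactness of the tensor product *)

Lemma image_closed (A B : zmodType) (f : {additive A -> B}) :
  zmod_closed (fun y => `[< exists x, f x = y >]).
Proof.
split=> [|u v /asboolP[x <-] /asboolP[y <-]]; apply/asboolP.
  by exists 0; rewrite raddf0.
by exists (x - y); rewrite raddfB.
Qed.

(** Images are packaged as subgroups to serve as the [H] of [tensor_map_ker]. *)
Definition image_subgroup (A B : zmodType) (f : {additive A -> B}) :
    zmodClosed B :=
  HB.pack_for (zmodClosed B) (fun y => `[< exists x, f x = y >])
    (GRing.isZmodClosed.Build B _ (image_closed f)).

Section RightExact.
Variable R : pzRingType.

Lemma tensor_map_surj (M M' : lmodType R^c) (N N' : lmodType R)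
    (f : {linear M -> M'}) (g : {linear N -> N'}) :
  (forall x, exists y, f y = x) -> (forall x, exists y, g y = x) ->
  forall t, exists u, tensor_map f g u = t.
Proof.
move=> fs gs; elim/tensor_ind=> [|x y t [u <-]]; first by exists 0; rewrite raddf0.
have [[x' <-] [y' <-]] := (fs x, gs y).
by exists (tens x' y' + u); rewrite raddfD tensor_mapE.
Qed.

(* H contains every [tens x y] with [f x = 0] or [g y = 0], so a choice of
   preimages under f and g defines an inverse of M (x) N / H -> M' (x) N'. *)
Lemma tensor_map_ker (M M' : lmodType R^c) (N N' : lmodType R)
    (f : {linear M -> M'}) (g : {linear N -> N'}) (H : zmodClosed (tensor M N)) :
  (forall x, exists y, f y = x) -> (forall x, exists y, g y = x) ->
  (forall x y, f x = 0 -> tens x y \in H) ->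
  (forall x y, g y = 0 -> tens x y \in H) ->
  forall t, tensor_map f g t = 0 -> t \in H.
Proof.
move=> fs gs fH gH.
pose s x := sval (cid (fs x)); pose r y := sval (cid (gs y)).
have sE x : f (s x) = x by rewrite /s; case: cid.
have rE y : g (r y) = y by rewrite /r; case: cid.
have tensBl x x' y : tens x y - tens x' y = tens (x - x') y :> tensor M N.
  by apply/eqP; rewrite subr_eq -tensDl subrK.
have tensBr x y y' : tens x y - tens x y' = tens x (y - y') :> tensor M N.
  by apply/eqP; rewrite subr_eq -tensDr subrK.
(* Modulo [H] a pure tensor depends only on the images of its factors under [f] and [g], so the
   choices [s] and [r] do not matter. *)
have piE x x' y y' : f x = f x' -> g y = g y' ->
    \pi_(Quotient.quot H) (tens x y) = \pi_(Quotient.quot H) (tens x' y').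
  move=> fx gy; apply/eqP; rewrite -Quotient.idealrBE.
  rewrite -(subrKA (tens x' y)) rpredD //.
    by rewrite tensBl; apply: fH; rewrite linearB fx subrr.
  by rewrite tensBr; apply: gH; rewrite linearB gy subrr.
pose b x y := \pi_(Quotient.quot H) (tens (s x) (r y)) : Quotient.quot H.
have bDl x x' y : b (x + x') y = b x y + b x' y.
  by rewrite /b -raddfD -tensDl; apply: piE; rewrite ?linearD ?sE ?rE.
have bDr x y y' : b x (y + y') = b x y + b x y'.
  by rewrite /b -raddfD -tensDr; apply: piE; rewrite ?linearD ?sE ?rE.
have bZ (a : R) x y : b ((a : R^c) *: x) y = b x (a *: y).
  (* The chosen preimage of the scaled element is traded for the scaled preimage, whose scalar can
     cross the tensor sign. *)
  rewrite /b (piE _ ((a : R^c) *: s x) _ (r y)) ?linearZ_LR ?sE //.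
  by rewrite tensZ; apply: piE; rewrite ?linearZ_LR ?sE ?rE.
pose L : {additive tensor M' N' -> Quotient.quot H} :=
  tensor_lift (Balanced bDl bDr bZ).
pose p : {additive tensor M N -> Quotient.quot H} := \pi_(Quotient.quot H).
move=> t t0.
have : L (tensor_map f g t) = p t.
  elim/tensor_ind: t {t0} => [|x y t IH]; first by rewrite !raddf0.
  rewrite !raddfD IH tensor_mapE; congr (_ + _).
  by rewrite [LHS]tensor_liftE; apply: piE; rewrite ?sE ?rE.
rewrite t0 raddf0 -(raddf0 p) => /eqP.
by rewrite eq_sym -Quotient.idealrBE subr0.
Qed.

Lemma tensor_exact_l (A B C : lmodType R^c) (N : lmodType R)
    (f : {linear A -> B}) (g : {linear B -> C}) :
  exact_at f g -> (forall x, exists y, g y = x) ->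
  exact_at (tensor_map f (idfun : {linear N -> N}))
           (tensor_map g (idfun : {linear N -> N})).
Proof.
move=> fg gs t; split=> [|[u <-]].
  move=> t0; apply/asboolP; move: t t0.
  apply: (@tensor_map_ker _ _ _ _ _ _ (image_subgroup _)) => //.
  - by move=> y; exists y.
  - move=> x y /fg[z <-]; apply/asboolP; exists (tens z y).
    by rewrite tensor_mapE.
  - by move=> x y y0; rewrite [y]y0 tens0r rpred0.
elim/tensor_ind: u => [|x y u IH]; first by rewrite !raddf0.
rewrite !raddfD IH !tensor_mapE /= (_ : g (f x) = 0) ?tens0l ?addr0 //.
by apply/fg; exists x.
Qed.

Lemma tensor_exact_r (M : lmodType R^c) (A B C : lmodType R)
    (f : {linear A -> B}) (g : {linear B -> C}) :
  exact_at f g -> (forall x, exists y, g y = x) ->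
  exact_at (tensor_map (idfun : {linear M -> M}) f)
           (tensor_map (idfun : {linear M -> M}) g).
Proof.
move=> fg gs t; split=> [|[u <-]].
  move=> t0; apply/asboolP; move: t t0.
  apply: (@tensor_map_ker _ _ _ _ _ _ (image_subgroup _)) => //.
  - by move=> y; exists y.
  - by move=> x y x0; rewrite [x]x0 tens0l rpred0.
  - move=> x y /fg[z <-]; apply/asboolP; exists (tens x z).
    by rewrite tensor_mapE.
elim/tensor_ind: u => [|x y u IH]; first by rewrite !raddf0.
rewrite !raddfD IH !tensor_mapE /= (_ : g (f y) = 0) ?tens0r ?addr0 //.
by apply/fg; exists y.
Qed.

End RightExact.

(** * Dual bases: projective modules are flat and Mittag-Leffler *)

Section DualBasis.
Variables (R : pzRingType) (P : lmodType R).

Definition coord (I : choiceType) (i : I) (u : free_mod R I) : R^o := coef u i.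

Lemma coord_is_linear (I : choiceType) (i : I) : linear (coord i).
Proof. by []. Qed.

HB.instance Definition _ (I : choiceType) (i : I) :=
  GRing.isLinear.Build R (free_mod R I) R^o *:%R (coord i) (coord_is_linear i).

(** The expansion is required on every duplicate-free list containing some [s], so that the lists of
    several elements can be merged into one. *)
Definition dual_basis (phi : P -> {linear P -> R^o}) : Prop :=
  forall u, exists s : seq P, forall s', uniq s' -> {subset s <= s'} ->
    u = \sum_(x <- s') (phi x u : R) *: x.

Lemma projective_dual_basis : projective P -> exists phi, dual_basis phi.
Proof.
move=> Pp.
(* [h] splits the free cover of [P]; its coordinates are the functionals. *)
have [h hE] := Pp _ _ (cover P) (idfun : {linear P -> P}) (@cover_surj _ P).
exists (fun x => coord x \o h) => u.
have /andP[_ /asboolP uP] := xchooseP (free_suppP (h u)).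
exists (free_supp (h u)) => s us sub.
rewrite -[LHS]/(idfun u) -hE; apply: free_extE => // i si; apply: uP.
by apply: contra si; apply: sub.
Qed.

End DualBasis.

Section Contraction.
Variable R : pzRingType.

Section Left.
Variables (M : lmodType R^c) (Q : lmodType R) (phi : {linear Q -> R^o}).

Lemma contract_l_Dl (x x' : M) y :
  (phi y : R^c) *: (x + x') = (phi y : R^c) *: x + (phi y : R^c) *: x'.
Proof. exact: scalerDr. Qed.
Lemma contract_l_Dr (x : M) y y' :
  (phi (y + y') : R^c) *: x = (phi y : R^c) *: x + (phi y' : R^c) *: x.
Proof. by rewrite linearD scalerDl. Qed.
Lemma contract_l_Z (r : R) (x : M) y :
  (phi y : R^c) *: ((r : R^c) *: x) = (phi (r *: y) : R^c) *: x.
Proof. by rewrite linearZ_LR scalerA. Qed.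

(** This is the map M ⊗ Q -> M ⊗ R = M induced by [phi]. *)
Definition contract_l : {additive tensor M Q -> M} :=
  tensor_lift (Balanced contract_l_Dl contract_l_Dr contract_l_Z).

Lemma contract_lE x y : contract_l (tens x y) = (phi y : R^c) *: x.
Proof. exact: tensor_liftE. Qed.

End Left.

Section Right.
Variables (P : lmodType R^c) (N : lmodType R) (phi : {linear P -> R^c^o}).

Lemma contract_r_Dl x x' (y : N) :
  (phi (x + x') : R) *: y = (phi x : R) *: y + (phi x' : R) *: y.
Proof. by rewrite linearD; apply: (scalerDl y (phi x : R) (phi x' : R)). Qed.
Lemma contract_r_Dr x (y y' : N) :
  (phi x : R) *: (y + y') = (phi x : R) *: y + (phi x : R) *: y'.
Proof. exact: scalerDr. Qed.
Lemma contract_r_Z (r : R) x (y : N) :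
  (phi ((r : R^c) *: x) : R) *: y = (phi x : R) *: (r *: y).
Proof. by rewrite linearZ_LR scalerA. Qed.

Definition contract_r : {additive tensor P N -> N} :=
  tensor_lift (Balanced contract_r_Dl contract_r_Dr contract_r_Z).

Lemma contract_rE x y : contract_r (tens x y) = (phi x : R) *: y.
Proof. exact: tensor_liftE. Qed.

End Right.

Lemma tens_suml (M : lmodType R^c) (N : lmodType R) (I : Type) (s : seq I)
    (x : I -> M) (y : N) :
  tens (\sum_(i <- s) x i) y = \sum_(i <- s) tens (x i) y.
Proof.
elim: s => [|i s IH]; first by rewrite !big_nil tens0l.
by rewrite !big_cons tensDl IH.
Qed.

Lemma tens_sumr (M : lmodType R^c) (N : lmodType R) (I : Type) (s : seq I)
    (x : M) (y : I -> N) :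
  tens x (\sum_(i <- s) y i) = \sum_(i <- s) tens x (y i).
Proof.
elim: s => [|i s IH]; first by rewrite !big_nil tens0r.
by rewrite !big_cons tensDr IH.
Qed.

(** Expanding second factors in the dual basis and moving the scalars to the left writes [t] as a
    finite sum of tensors whose first factors are its contractions. *)
Lemma contract_l_eq0 (M : lmodType R^c) (Q : lmodType R)
    (phi : Q -> {linear Q -> R^o}) (t : tensor M Q) :
  dual_basis phi -> (forall z, contract_l M (phi z) t = 0) -> t = 0.
Proof.
move=> bphi t0.
suff [s tE] : exists s : seq Q, forall s', uniq s' -> {subset s <= s'} ->
    t = \sum_(z <- s') tens (contract_l M (phi z) t) z :> tensor M Q.
  rewrite (tE _ (undup_uniq s)); last by move=> z; rewrite mem_undup.
  by apply: big1 => z _; rewrite t0 tens0l.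
elim/tensor_ind: t {t0} => [|x y t [s IH]].
  by exists [::] => s _ _; rewrite big1 // => z _; rewrite raddf0 tens0l.
have [s' yE] := bphi y; exists (s' ++ s) => s'' us sub.
under eq_bigr => z _ do rewrite raddfD contract_lE tensDl tensZ.
rewrite big_split -tens_sumr -IH //; last first.
  by move=> z zs; apply: sub; rewrite mem_cat zs orbT.
by rewrite -yE // => z zs; apply: sub; rewrite mem_cat zs.
Qed.

Lemma contract_r_eq0 (P : lmodType R^c) (N : lmodType R)
    (phi : P -> {linear P -> R^c^o}) (t : tensor P N) :
  dual_basis phi -> (forall z, contract_r N (phi z) t = 0) -> t = 0.
Proof.
move=> bphi t0.
suff [s tE] : exists s : seq P, forall s', uniq s' -> {subset s <= s'} ->
    t = \sum_(z <- s') tens z (contract_r N (phi z) t) :> tensor P N.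
  rewrite (tE _ (undup_uniq s)); last by move=> z; rewrite mem_undup.
  by apply: big1 => z _; rewrite t0 tens0r.
elim/tensor_ind: t {t0} => [|x y t [s IH]].
  by exists [::] => s _ _; rewrite big1 // => z _; rewrite raddf0 tens0r.
have [s' xE] := bphi x; exists (s' ++ s) => s'' us sub.
under eq_bigr => z _ do rewrite raddfD contract_rE tensDr -tensZ.
rewrite big_split -tens_suml -IH //; last first.
  by move=> z zs; apply: sub; rewrite mem_cat zs orbT.
by rewrite -xE // => z zs; apply: sub; rewrite mem_cat zs.
Qed.

(** Contractions are natural in [M]: the injective [f] sends those of a kernel element to 0, so they
    all vanish. *)
Lemma projective_flat_l (M M' : lmodType R^c) (Q : lmodType R)
    (f : {linear M -> M'}) : projective Q -> injective f ->
  injective (tensor_map f (idfun : {linear Q -> Q})).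
Proof.
move=> /projective_dual_basis[phi bphi] finj; apply: raddf_inj => t t0.
apply: (contract_l_eq0 bphi) => z; apply: finj.
have <- : contract_l M' (phi z) (tensor_map f (idfun : {linear Q -> Q}) t) =
    f (contract_l M (phi z) t).
  elim/tensor_ind: t {t0} => [|x y t IH]; first by rewrite !raddf0.
  by rewrite !raddfD IH tensor_mapE !contract_lE; congr (_ + _);
    apply/esym/linearZ_LR.
by rewrite t0 !raddf0.
Qed.

Lemma projective_flat_r (P : lmodType R^c) (N N' : lmodType R)
    (f : {linear N -> N'}) : projective P -> injective f ->
  injective (tensor_map (idfun : {linear P -> P}) f).
Proof.
move=> /projective_dual_basis[phi bphi] finj; apply: raddf_inj => t t0.
apply: (contract_r_eq0 bphi) => z; apply: finj.
have <- : contract_r N' (phi z) (tensor_map (idfun : {linear P -> P}) f t) =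
    f (contract_r N (phi z) t).
  elim/tensor_ind: t {t0} => [|x y t IH]; first by rewrite !raddf0.
  by rewrite !raddfD IH tensor_mapE !contract_rE; congr (_ + _);
    apply/esym/linearZ_LR.
by rewrite t0 !raddf0.
Qed.

(** Projectives are Mittag-Leffler for every class: component [i] of a contraction of [t] is the
    contraction of the image of [t] over [F i]. *)
Lemma projective_tensor_prod_eq0 (I : Type) (F : I -> lmodType R^c)
    (Q : lmodType R) (t : tensor (prod_mod F) Q) :
  projective Q -> (forall i, tensor_prod_map t i = 0) -> t = 0.
Proof.
move=> /projective_dual_basis[phi bphi] t0; apply: (contract_l_eq0 bphi) => z.
apply: functional_extensionality_dep => i.
have <- : contract_l (F i) (phi z) (tensor_prod_map t i) =
    contract_l (prod_mod F) (phi z) t i.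
  rewrite /tensor_prod_map.
  elim/tensor_ind: t {t0} => [|x y t IH]; first by rewrite !raddf0.
  by rewrite !raddfD IH tensor_mapE !contract_lE.
by rewrite t0 raddf0.
Qed.

Lemma ML_P (X : lmodType R^c -> Prop) (M : lmodType R) :
  ML X M <-> forall (I : Type) (F : I -> lmodType R^c), (forall i, X (F i)) ->
    forall t : tensor (prod_mod F) M,
      (forall i, tensor_prod_map t i = 0) -> t = 0.
Proof.
split=> MLM I F XF.
  move=> t t0; apply: (MLM I F XF); apply: functional_extensionality_dep => i.
  by rewrite t0 /tensor_prod_map raddf0.
move=> t u tu; apply/eqP; rewrite -subr_eq0; apply/eqP; apply: (MLM I F XF) => i.
have /= := congr1 (@^~ i) tu; rewrite /tensor_prod_map raddfB => ->.
exact: subrr.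
Qed.

End Contraction.

(** * Balance and dimension shifting for the vanishing of Tor_1 *)

Section ThreeByThree.
Variables KL KQ KN PL PQ PN AL AQ : zmodType.
Variables (kl : {additive KL -> KQ}) (kq : {additive KQ -> KN}).
Variables (pl : {additive PL -> PQ}) (pq : {additive PQ -> PN}).
Variables (al : {additive AL -> AQ}).
Variables (vL : {additive KL -> PL}) (wL : {additive PL -> AL}).
Variables (vQ : {additive KQ -> PQ}) (wQ : {additive PQ -> AQ}).
Variable vN : {additive KN -> PN}.

(** The grid is (K -> P -> A) ⊗ (L -> Q -> N), with [KL] for K ⊗ L and so on. A kernel element of
    [vN] is lifted to [KQ], pushed to [PQ], pulled back to [PL] and, by injectivity of [al], to
    [KL]; hence it is zero. *)
Lemma three_by_three :
  (forall x, exists y, kq y = x) -> exact_at kl kq -> exact_at pl pq ->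
  exact_at vL wL -> exact_at vQ wQ -> injective vQ ->
  (forall x, pl (vL x) = vQ (kl x)) -> (forall x, vN (kq x) = pq (vQ x)) ->
  (forall x, wQ (pl x) = al (wL x)) ->
  injective al -> injective vN.
Proof.
move=> kqs kE pE vwL vwQ vQi sq1 sq2 sq3 ali; apply: raddf_inj => x.
have [y <-] := kqs x; rewrite sq2 => /pE[z zE].
have /vwL[w wE] : wL z = 0.
  by apply: ali; rewrite -sq3 zE raddf0; apply/vwQ; exists y.
have <- : kl w = y by apply: vQi; rewrite -sq1 wE.
by apply/kE; exists w.
Qed.

End ThreeByThree.

Section Tor.
Variable R : pzRingType.

Lemma tensor_map_swap (M M' : lmodType R^c) (N N' : lmodType R)
    (f : {linear M -> M'}) (g : {linear N -> N'}) t :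
  (M' ⊗> g) ((f <⊗ N) t) = (f <⊗ N') ((M ⊗> g) t).
Proof.
by rewrite (tensor_map_comp (h := f) (k := g)) ?(tensor_map_comp (h := f) (k := g)).
Qed.

(** The chase runs once on the grid, using flatness of [Q], and once on its transpose, using
    flatness of [P]. *)
Lemma tor_balance (K P A : lmodType R^c) (f : {linear K -> P})
    (g : {linear P -> A}) (L Q N : lmodType R) (f' : {linear L -> Q})
    (g' : {linear Q -> N}) :
  short_exact f g -> short_exact f' g' -> projective P -> projective Q ->
  injective (f <⊗ N) <-> injective (A ⊗> f').
Proof.
move=> [fi fg gs] [f'i f'g' g's] Pp Qp; split; last first.
  apply: (@three_by_three _ _ _ _ _ _ _ _ (K ⊗> f') (K ⊗> g')
    (P ⊗> f') (P ⊗> g') _ (f <⊗ L) (g <⊗ L) (f <⊗ Q) (g <⊗ Q));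
    try (by move=> x; rewrite tensor_map_swap).
  - by apply: tensor_map_surj => // y; exists y.
  - exact: tensor_exact_r.
  - exact: tensor_exact_r.
  - exact: tensor_exact_l.
  - exact: tensor_exact_l.
  - exact: projective_flat_l.
apply: (@three_by_three _ _ _ _ _ _ _ _ (f <⊗ L) (g <⊗ L) (f <⊗ Q) (g <⊗ Q)
  _ (K ⊗> f') (K ⊗> g') (P ⊗> f') (P ⊗> g'));
  try (by move=> x; rewrite tensor_map_swap).
- by apply: tensor_map_surj => // y; exists y.
- exact: tensor_exact_l.
- exact: tensor_exact_l.
- exact: tensor_exact_r.
- exact: tensor_exact_r.
- exact: projective_flat_r.
Qed.

Definition ker_incl (S : pzRingType) (U V : lmodType S) (f : {linear U -> V}) :
  {linear kernel f -> U} := (val : kernel f -> U).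

Lemma ker_short_exact (S : pzRingType) (U V : lmodType S) (f : {linear U -> V}) :
  (forall x, exists y, f y = x) -> short_exact (ker_incl f) f.
Proof.
move=> fs; split=> //; first exact: val_inj.
move=> y; split=> [/eqP y0|[x <-]]; first by exists (Kernel y0).
exact: (kernelP x).
Qed.

(* Tor_1(A, N) = 0, computed from the free cover of N *)
Definition tor_free (A : lmodType R^c) (N : lmodType R) : Prop :=
  injective (A ⊗> ker_incl (cover N)).

Lemma tor_free_l (K P A : lmodType R^c) (f : {linear K -> P})
    (g : {linear P -> A}) (N : lmodType R) :
  short_exact f g -> projective P -> injective (f <⊗ N) <-> tor_free A N.
Proof.
move=> fg Pp; have cov := ker_short_exact (@cover_surj _ N).
by apply: tor_balance fg cov Pp _; apply: free_projective.
Qed.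

(** Balancing twice, through the free cover of [A], replaces the free cover of [N] by an arbitrary
    projective presentation. *)
Lemma tor_free_r (A : lmodType R^c) (L Q N : lmodType R) (f : {linear L -> Q})
    (g : {linear Q -> N}) :
  short_exact f g -> projective Q -> injective (A ⊗> f) <-> tor_free A N.
Proof.
move=> fg Qp; have cov := ker_short_exact (@cover_surj _ A).
rewrite -(tor_free_l N cov (@free_projective _ _)).
by apply: iff_sym; apply: tor_balance cov fg _ Qp; apply: free_projective.
Qed.

Lemma tor_free_shift (K P A : lmodType R^c) (f : {linear K -> P})
    (g : {linear P -> A}) (L Q N : lmodType R) (f' : {linear L -> Q})
    (g' : {linear Q -> N}) :
  short_exact f g -> short_exact f' g' -> projective P -> projective Q ->
  tor_free K N <-> tor_free A L.
Proof.
move=> fg fg' Pp Qp; rewrite -(tor_free_r K fg' Qp) -(tor_free_l L fg Pp).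
have [fi _ _] := fg; have [fi' _ _] := fg'.
(* Flatness embeds both K ⊗ Q and P ⊗ L in P ⊗ Q, where the two conditions meet. *)
have fQ := projective_flat_l Qp fi; have Pf := projective_flat_r Pp fi'.
split=> inj; apply: raddf_inj => t t0.
  by apply: inj; apply: fQ; rewrite -tensor_map_swap t0 !raddf0.
by apply: inj; apply: Pf; rewrite tensor_map_swap t0 !raddf0.
Qed.

End Tor.

(** * Syzygies of a projective resolution *)

Section Syzygies.
Variables (R : pzRingType) (M : lmodType R) (P : resolution M).

(* shifted so that [syz 0] is M and [syz k.+1] is the k-th syzygy of Defs *)
Definition syz (k : nat) : lmodType R := if k is j.+1 then syzygy P j else M.

Section Factor.
Variables (U V W : lmodType R) (f : {linear U -> V}) (g : {linear V -> W}).
Hypothesis gf0 : forall x, g (f x) == 0.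

(** For consecutive maps of a resolution, this corestriction is the surjection of a projective term
    onto a syzygy. *)
Definition ker_factor (x : U) : kernel g := Kernel (gf0 x).

Lemma ker_factor_is_linear : linear ker_factor.
Proof. by move=> a x y; apply: val_inj; rewrite /= linearP. Qed.

HB.instance Definition _ :=
  GRing.isLinear.Build R U (kernel g) *:%R ker_factor ker_factor_is_linear.

Lemma ker_factor_short_exact :
  exact_at f g -> short_exact (ker_incl f) ker_factor.
Proof.
move=> fg; split; first exact: val_inj.
  move=> y; split=> [y0|[x <-]]; last by apply: val_inj; apply: (kernelP x).
  have fy : f y == 0 by apply/eqP; exact: (congr1 val y0).
  by exists (Kernel fy).
move=> c; have /fg[x xE] := kernelP c.
by exists x; apply: val_inj.
Qed.

End Factor.

Lemma syz_short_exact (k : nat) :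
  exists (f : {linear syz k.+1 -> res_mod P k}) (g : {linear res_mod P k -> syz k}),
    short_exact f g.
Proof.
case: k => [|k].
  exists (ker_incl (res_aug P)), (res_aug P).
  by apply: ker_short_exact; apply: res_aug_surj.
case: k => [|k].
  have ex := @res_exact0 _ _ P.
  have gf x : res_aug P (res_d P 0 x) == 0 by apply/eqP/ex; exists x.
  exists (ker_incl (res_d P 0)), (ker_factor gf).
  exact: ker_factor_short_exact.
have ex := @res_exactS _ _ P k.
have gf x : res_d P k (res_d P k.+1 x) == 0 by apply/eqP/ex; exists x.
exists (ker_incl (res_d P k.+1)), (ker_factor gf).
exact: ker_factor_short_exact.
Qed.

End Syzygies.

Lemma dim_leP (R : pzRingType) (X : lmodType R -> Prop) (n : nat)
    (M : lmodType R) : dim_le X n M <-> exists P : resolution M, X (syz P n).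
Proof.
case: n => [|n] //=; split=> [XM|[]] //.
by exists (std_resolution M).
Qed.

(** * Vanishing of Tor_1 along syzygies, retracts and direct sums *)

Section TorSyzygies.
Variable R : pzRingType.

(** Syzygies are shifted one at a time. The case n = 0 shows that the right-hand condition does not
    depend on the resolution [Q] of [N]. *)
Lemma tor_free_syz (A : lmodType R^c) (N : lmodType R) (P : resolution A)
    (Q : resolution N) (m n : nat) :
  tor_free (syz P m) (syz Q n) <-> tor_free A (syz Q (m + n)).
Proof.
elim: m n => [|m IH] n //.
rewrite addSnnS -IH.
have [f [g fg]] := syz_short_exact P m; have [f' [g' fg']] := syz_short_exact Q n.
by apply: tor_free_shift fg fg' _ _; apply: res_proj.
Qed.

Lemma Tor1_eq0P (A : lmodType R^c) (N : lmodType R) :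
  Tor1_eq0 A N <-> tor_free A N.
Proof.
suff TorP (P : resolution A) : (forall t : Tor1 P N, t = 0) <-> tor_free A N.
  by split=> [/(_ (std_resolution A))/TorP|AN P] //; apply/TorP.
have ex0 := @res_exact0 _ _ P; have ex1 := @res_exactS _ _ P 0.
have gf x : res_aug P (res_d P 0 x) == 0 by apply/eqP/ex0; exists x.
have [_ _ gs] := ker_factor_short_exact gf ex0.
(* d_1 ⊗ N factors through ΩA ⊗ N; the first factor is onto and its kernel is the image of d_2 ⊗ N,
   so the homology vanishes iff ΩA ⊗ N -> P_0 ⊗ N is injective. *)
have d0E y : (ker_incl (res_aug P) <⊗ N) ((ker_factor gf <⊗ N) y)
    = (res_d P 0 <⊗ N) y by apply: tensor_map_comp.
have gex : exact_at (res_d P 1) (ker_factor gf).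
  move=> y; rewrite -ex1; split=> [/(congr1 val)//|y0].
  exact: val_inj.
have gN := @tensor_exact_l _ _ _ _ N _ _ gex gs.
rewrite -(tor_free_l N (ker_short_exact (@res_aug_surj _ _ P)) (@res_proj _ _ P 0)).
rewrite homology_eq0; split=> [ex|inj y].
  apply: raddf_inj => t.
  have [y <-] : exists y, (ker_factor gf <⊗ N) y = t.
    by apply: tensor_map_surj => // z; exists z.
  by rewrite d0E => /ex y0; apply/gN.
by rewrite -d0E => y0; apply/gN/inj; rewrite y0 raddf0.
Qed.

(** Composing the cover of [A] with [f] presents [B] with the same kernel, hence with the same test
    map. *)
Lemma tor_free_iso (A B : lmodType R^c) (N : lmodType R) (f : {linear A -> B}) :
  bijective f -> tor_free A N <-> tor_free B N.
Proof.
move=> [g fK gK]; have cov := ker_short_exact (@cover_surj _ A).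
have [ki kex ks] := cov.
have pA : projective (free_mod R^c A) by apply: free_projective.
have kB : short_exact (ker_incl (cover A)) (f \o cover A).
  split=> // [y|c]; last first.
    by have [b bE] := ks (g c); exists b; rewrite /= bE gK.
  rewrite -kex /=; split=> [|->]; last exact: raddf0.
  by rewrite -[in X in X -> _](raddf0 f) => /(can_inj fK).
by rewrite -(tor_free_l N kB pA) -(tor_free_l N cov pA).
Qed.

Section Retract.
Variables (N N' : lmodType R) (i : {linear N -> N'}) (p : {linear N' -> N}).
Hypothesis iK : cancel i p.

Lemma tensor_retract (A : lmodType R^c) (t : tensor A N) :
  (A ⊗> p) ((A ⊗> i) t) = t.
Proof.
by rewrite (tensor_map_comp (h := idfun) (k := idfun)) //; apply: tensor_map_id.
Qed.

Lemma tor_free_retract (A : lmodType R^c) : tor_free A N' -> tor_free A N.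
Proof.
have cov := ker_short_exact (@cover_surj _ A).
have pA : projective (free_mod R^c A) by apply: free_projective.
rewrite -(tor_free_l N' cov pA) -(tor_free_l N cov pA) => inj.
apply: raddf_inj => t t0; rewrite -[t]tensor_retract.
suff -> : (_ ⊗> i) t = 0 by rewrite raddf0.
by apply: inj; rewrite -tensor_map_swap t0 !raddf0.
Qed.

Lemma ML_retract (X : lmodType R^c -> Prop) : ML X N' -> ML X N.
Proof.
move=> /ML_P MLN'; apply/ML_P => I F XF t t0.
rewrite -[t]tensor_retract.
suff -> : (_ ⊗> i) t = 0 by rewrite raddf0.
by apply: (MLN' I F XF) => j; rewrite /tensor_prod_map -tensor_map_swap
  [X in (_ ⊗> i) X]t0 raddf0.
Qed.

End Retract.

Section DirectSum.
Variables M N : lmodType R.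

Definition inj1 (x : M) : (M * N)%type := (x, 0).
Definition inj2 (y : N) : (M * N)%type := (0, y).

Lemma inj1_is_linear : linear inj1.
Proof. by move=> a x y; congr (_, _); rewrite /= scaler0 addr0. Qed.
Lemma inj2_is_linear : linear inj2.
Proof. by move=> a x y; congr (_, _); rewrite /= scaler0 addr0. Qed.

HB.instance Definition _ :=
  GRing.isLinear.Build R M (M * N)%type *:%R inj1 inj1_is_linear.
HB.instance Definition _ :=
  GRing.isLinear.Build R N (M * N)%type *:%R inj2 inj2_is_linear.

Lemma tor_free_sum (A : lmodType R^c) :
  tor_free A M -> tor_free A N -> tor_free A (M * N)%type.
Proof.
have cov := ker_short_exact (@cover_surj _ A).
have pA : projective (free_mod R^c A) by apply: free_projective.
rewrite -(tor_free_l M cov pA) -(tor_free_l N cov pA).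
rewrite -(tor_free_l (M * N)%type cov pA) => injM injN.
apply: raddf_inj => t t0.
have tE B (u : tensor B (M * N)%type) : u =
   (B ⊗> (inj1 : {linear M -> (M * N)%type}))
     ((B ⊗> (fst : {linear (M * N)%type -> M})) u) +
   (B ⊗> (inj2 : {linear N -> (M * N)%type}))
     ((B ⊗> (snd : {linear (M * N)%type -> N})) u).
  elim/tensor_ind: u => [|x y u IH]; first by rewrite !raddf0 addr0.
  rewrite !raddfD {1}IH !tensor_mapE /= addrACA -tensDr; congr (tens _ _ + _).
  by case: y => y z; congr (_, _); rewrite /= ?addr0 ?add0r.
rewrite [t]tE.
have -> : (_ ⊗> (fst : {linear (M * N)%type -> M})) t = 0.
  by apply: injM; rewrite -tensor_map_swap t0 !raddf0.
have -> : (_ ⊗> (snd : {linear (M * N)%type -> N})) t = 0.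
  by apply: injN; rewrite -tensor_map_swap t0 !raddf0.
by rewrite !raddf0 addr0.
Qed.

End DirectSum.

End TorSyzygies.

(** * Least bounds and relative dimensions *)

Lemma leastP (A : nat -> Prop) (n : nat) :
  least A = Some n <-> A n /\ forall m, A m -> (n <= m)%N.
Proof.
rewrite /least; case: pselect => [exA|nexA]; last first.
  by split=> // -[An _]; case: nexA; exists n; apply/asboolP.
case: ex_minnP => k /asboolP Ak kmin; split=> [[<-]|[An nmin]].
  by split=> // m Am; apply/kmin/asboolP.
by congr Some; apply/eqP; rewrite eqn_leq nmin // andbT; apply/kmin/asboolP.
Qed.

(** For a general class, [dim_le X] need not be monotone in its bound, so some [m] at most [b]
    appears in place of [b]. *)
Lemma pd_leP (R : pzRingType) (X : lmodType R -> Prop) (M : lmodType R) (b : nat) :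
  (exists2 m, pd X M = Some m & (m <= b)%N) <->
  (exists2 m, dim_le X m M & (m <= b)%N).
Proof.
split=> [[m /leastP[Xm _] mb]|[m Xm mb]]; first by exists m.
have exX : exists k, `[< dim_le X k M >] by exists m; apply/asboolP.
have [k /asboolP Xk kmin] := ex_minnP exX.
exists k; last by apply: leq_trans mb; apply/kmin/asboolP.
by apply/leastP; split=> // j Xj; apply/kmin/asboolP.
Qed.

Lemma pd_classP (R : pzRingType) (X Y : lmodType R -> Prop) (n : nat) :
  pd_class X Y = Some n <->
  (forall M, Y M -> exists2 m, dim_le X m M & (m <= n)%N) /\
  forall b, (forall M, Y M -> exists2 m, dim_le X m M & (m <= b)%N) ->
    (n <= b)%N.
Proof.
have bE b : (forall M, Y M -> exists2 m, pd X M = Some m & (m <= b)%N) <->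
    (forall M, Y M -> exists2 m, dim_le X m M & (m <= b)%N).
  by split=> H M YM; apply/pd_leP/H.
by rewrite /pd_class leastP bE; split=> -[H min]; split=> // b /bE; apply: min.
Qed.

(** * Hereditary Tor-pairs and the equivalence of the two bounds *)

Section Hereditary.
Variables (R : pzRingType) (T : lmodType R^c -> Prop) (S : lmodType R -> Prop).
Hypothesis hTS : hereditary_tor_pair T S.

Lemma T_P (M : lmodType R^c) : T M <-> forall N, S N -> tor_free M N.
Proof.
have [[TE _] _] := hTS; rewrite TE.
by split=> MN N /MN/Tor1_eq0P.
Qed.

Lemma S_P (N : lmodType R) : S N <-> forall M, T M -> tor_free M N.
Proof.
have [[_ SE] _] := hTS; rewrite SE.
by split=> MN M /MN/Tor1_eq0P.
Qed.

Lemma T_syz (M : lmodType R^c) (P : resolution M) (n : nat) :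
  T (syz P n) -> T (syz P n.+1).
Proof.
have [_ [Tp _ Tk]] := hTS; have [f [g fg]] := syz_short_exact P n.
by apply: Tk fg _; apply: Tp; apply: res_proj.
Qed.

(** Tor_1(M, ΩN) vanishes with Tor_1(ΩM, N), and ΩM stays in [T] by closure under kernels of
    epimorphisms. *)
Lemma S_syz (N : lmodType R) (Q : resolution N) (n : nat) : S N -> S (syz Q n).
Proof.
move=> SN; elim: n => [|n /S_P IH] //; apply/S_P => M TM.
apply/(tor_free_syz (std_resolution M) Q 0 n.+1).
rewrite add0n -addn1 addnC -(tor_free_syz (std_resolution M)).
by apply: IH; apply: T_syz.
Qed.

(** Moving n syzygies from [A] to [N] eliminates the chosen resolution of [A]. *)
Lemma dim_le_T (n : nat) (A : lmodType R^c) :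
  dim_le T n A <->
  forall N, S N -> forall Q : resolution N, tor_free A (syz Q n).
Proof.
rewrite dim_leP; split=> [[P /T_P TP] N SN Q|AN].
  by rewrite -[n]addn0 -(tor_free_syz P); apply: TP.
exists (std_resolution A); apply/T_P => N SN.
by apply/(tor_free_syz _ (std_resolution N) n 0); rewrite addn0; apply: AN.
Qed.

(* Both sides say that (prod F) (x) L -> (prod F) (x) Q is injective, because
   the F i (x) L -> F i (x) Q are injective and Q is Mittag-Leffler. *)
Lemma ML_kernel (L Q N : lmodType R) (f : {linear L -> Q}) (g : {linear Q -> N}) :
  short_exact f g -> projective Q -> S N ->
  ML T L <-> forall (I : Type) (F : I -> lmodType R^c), (forall i, T (F i)) ->
    tor_free (prod_mod F) N.
Proof.
move=> fg Qp /S_P SN; rewrite ML_P.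
split=> H I F TF.
  apply/(tor_free_r _ fg Qp)/raddf_inj => t t0.
  apply: (H I F TF) => i; have /(tor_free_r _ fg Qp) := SN _ (TF i).
  by apply; rewrite /tensor_prod_map tensor_map_swap t0 !raddf0.
move=> t t0; have /(tor_free_r _ fg Qp) := H I F TF.
apply; rewrite raddf0; apply: projective_tensor_prod_eq0 => // i.
by rewrite /tensor_prod_map -tensor_map_swap [X in tensor_map _ _ X]t0 raddf0.
Qed.

Lemma dim_le_ML (n : nat) (N : lmodType R) : S N ->
  dim_le (ML T) n.+1 N <->
  forall (I : Type) (F : I -> lmodType R^c), (forall i, T (F i)) ->
    forall Q : resolution N, tor_free (prod_mod F) (syz Q n).
Proof.
move=> SN; rewrite dim_leP.
have MLQ (Q : resolution N) : ML T (syz Q n.+1) <->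
    forall (I : Type) (F : I -> lmodType R^c), (forall i, T (F i)) ->
    tor_free (prod_mod F) (syz Q n).
  have [f [g fg]] := syz_short_exact Q n.
  by apply: ML_kernel fg _ _; [apply: res_proj | apply: S_syz].
split=> [[Q /MLQ H] I F TF Q'|H]; last first.
  by exists (std_resolution N); apply/MLQ => I F TF; apply: H.
(* With all n syzygies moved to the product, [Q] and [Q'] both reduce to [N]. *)
move: (H I F TF); rewrite -[n]addn0 -!(tor_free_syz (std_resolution _)).
by [].
Qed.

Lemma dim_le_prodP (n : nat) :
  (forall (I : Type) (F : I -> lmodType R^c),
      (forall i, T (F i)) -> dim_le T n (prod_mod F)) <->
  (forall M : lmodType R, S M -> dim_le (ML T) n.+1 M).
Proof.
split=> H.
  move=> M SM; apply/dim_le_ML => // I F TF Q.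
  by have /dim_le_T := H I F TF; apply.
move=> I F TF; apply/dim_le_T => N SN Q.
by have /(dim_le_ML _ SN) := H N SN; apply.
Qed.

(** * From bounds to exact values of the dimensions *)

Lemma dim_le_T_leq (m n : nat) (A : lmodType R^c) :
  (m <= n)%N -> dim_le T m A -> dim_le T n A.
Proof.
move=> mn /dim_leP[P TP]; apply/dim_leP; exists P.
elim: n mn => [|n IH]; first by case: m TP.
by rewrite leq_eqVlt => /predU1P[<- //|/IH]; apply: T_syz.
Qed.

Lemma pd_Prod_leP (b : nat) :
  (forall M, Prod T M -> exists2 m, dim_le T m M & (m <= b)%N) <->
  (forall (I : Type) (F : I -> lmodType R^c),
      (forall i, T (F i)) -> dim_le T b (prod_mod F)).
Proof.
split=> H.
  move=> I F TF; have [|m Tm mb] := H (prod_mod F).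
    by exists I, F; split=> //; exists idfun; exists idfun.
  exact: dim_le_T_leq mb Tm.
move=> M [I [F [TF [f fb]]]]; exists b => //.
(* The Tor criterion crosses the isomorphism without transporting a resolution. *)
apply/dim_le_T => N SN Q; apply/(tor_free_iso _ fb).
by have /dim_le_T := H I F TF; apply.
Qed.

(** For positive n, the Tor criterion with all syzygies on the product leaves only [N] and [N'] to
    compare, so their resolutions need not be related. *)
Lemma dim_le_ML_retract (n : nat) (N N' : lmodType R) (i : {linear N -> N'})
    (p : {linear N' -> N}) : cancel i p -> S N -> S N' ->
  dim_le (ML T) n N' -> dim_le (ML T) n N.
Proof.
move=> iK SN SN'; case: n => [|n]; first exact: ML_retract iK _.
move=> /(dim_le_ML n SN') N'n; apply/(dim_le_ML n SN) => I F TF Q.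
rewrite -[n]addn0 -(tor_free_syz (std_resolution _)).
apply: (tor_free_retract iK); move: (N'n I F TF (std_resolution N')).
by rewrite -[n in X in X -> _]addn0 -(tor_free_syz (std_resolution _)).
Qed.

Lemma S_sum (M N : lmodType R) : S M -> S N -> S (M * N)%type.
Proof.
move=> /S_P SM /S_P SN; apply/S_P => A TA.
by apply: tor_free_sum; [apply: SM | apply: SN].
Qed.

(* Having ML(T)-dimension at most b is not monotone in b for a single module;
   adding a module of the largest dimension repairs this. *)
Lemma pd_ML_dim_le (b : nat) : pd_class (ML T) S = Some b.+1 ->
  forall M : lmodType R, S M -> dim_le (ML T) b.+1 M.
Proof.
move=> /pd_classP[H min] M SM.
(* Minimality of b + 1 forces some [N] in [S] to have no dimension bound at most b. *)
have [N SN Nb] : exists2 N, S N & forall m, (m <= b)%N -> ~ dim_le (ML T) m N.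
  apply: contrapT => nN; suff /min : forall N, S N ->
      exists2 m, dim_le (ML T) m N & (m <= b)%N by rewrite ltnn.
  move=> N SN; apply: contrapT => nm; apply: nN; exists N => // m mb Nm.
  by apply: nm; exists m.
have SMN := S_sum SM SN.
(* The bound m of the sum is either b + 1, which passes to [M], or at most b, which would pass to
   [N]. *)
have [m MNm] := H _ SMN; rewrite leq_eqVlt => /predU1P[mb|mb].
  by rewrite -mb; apply: (@dim_le_ML_retract _ _ _ (@inj1 R M N) fst).
by case: (Nb m mb); apply: (@dim_le_ML_retract _ _ _ (@inj2 R M N) snd).
Qed.

Lemma pd_class_ProdE (n : nat) :
  (n = 0%N -> exists2 M : lmodType R, S M & ~ ML T M) ->
  pd_class T (Prod T) = Some n <-> pd_class (ML T) S = Some n.+1.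
Proof.
move=> n0; split=> [/pd_classP[/pd_Prod_leP/dim_le_prodP Vn min]|pdS].
  (* The bound n + 1 holds on [S], so a least bound [b] exists; it remains to exclude b <= n. *)
  have ex : exists b, `[< forall M, S M ->
      exists2 m, dim_le (ML T) m M & (m <= b)%N >].
    by exists n.+1; apply/asboolP => M /Vn ?; exists n.+1.
  have [b /asboolP Db bmin] := ex_minnP ex.
  have pdb : pd_class (ML T) S = Some b.
    by apply/pd_classP; split=> // k Dk; apply/bmin/asboolP.
  rewrite pdb; congr Some; apply/eqP; rewrite eqn_leq bmin ?andTb; last first.
    by apply/asboolP => M /Vn ?; exists n.+1.
  case: b pdb Db {bmin} => [_ D0|b /pd_ML_dim_le/dim_le_prodP/pd_Prod_leP/min //].
  (* If b = 0, then [S] lies in ML(T); first syzygies stay in [S], so the bound 1 also holds, whence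
     n = 0 by minimality, against [n0]. *)
  have SML M : S M -> ML T M by move=> /D0[[|//]].
  have /dim_le_prodP/pd_Prod_leP/min : forall M, S M -> dim_le (ML T) 1 M.
    by move=> M SM; exists (std_resolution M); apply/SML/(S_syz _ 1).
  by rewrite leqn0 => /eqP/n0[M /SML].
apply/pd_classP; split; first by apply/pd_Prod_leP/dim_le_prodP/pd_ML_dim_le.
(* A bound b on products yields the bound b + 1 on [S], so minimality descends. *)
move=> b /pd_Prod_leP/dim_le_prodP Vb; have /pd_classP[_ min] := pdS.
by apply: (min b.+1) => M /Vb ?; exists b.+1.
Qed.

End Hereditary.

Local Close Scope ring_scope.

(* For n = 0 the last equivalence requires that S is not contained in ML(T):
   otherwise pd_T(Prod(T)) = 0 while pd_ML(T)(S) = 0, not 1 (over a field, for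
   instance, with T and S the classes of all modules). *)
Theorem theorem2p1 (R : pzRingType) (T : lmodType R^c -> Prop)
    (S : lmodType R -> Prop) (n : nat) (hTS : hereditary_tor_pair T S) :
  ((forall (I : Type) (F : I -> lmodType R^c),
      (forall i, T (F i)) -> dim_le T n (prod_mod F)) <->
   (forall M : lmodType R, S M -> dim_le (ML T) n.+1 M)) /\
  ((n = 0 -> exists2 M : lmodType R, S M & ~ ML T M) ->
   (pd_class T (Prod T) = Some n <-> pd_class (ML T) S = Some n.+1)).
Proof. by split; [apply: dim_le_prodP | apply: pd_class_ProdE]. Qed.
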